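(* Let $r\ge1$, $n\ge k\ge1$, let $X_1,\dots,X_n$ be independent nonnegative random variables with finite means, and for $S\subseteq N=\{1,\dots,n\}$ let $u(S)=\mathbb{E}\big[(\sum_{i\in S}X_i^r)^{1/r}\big]$. Let $M$ be any set of $k$ elements of $N$ with the highest mean test scores $\mathbb{E}[X_i]$, and let $\mathrm{OPT}$ maximize $u$ over subsets of $N$ of size $k$. Then $$u(M)\ \ge\ \frac{1}{k^{1-1/r}}\,u(\mathrm{OPT}).$$ Moreover, this bound is tight: for every $k\ge1$, $r\ge1$ and $\delta>0$ there exist $n$ and independent nonnegative random variables $X_1,\dots,X_n$ for which some such set $M$ satisfies $u(M)\le (1+\delta)\,k^{-(1-1/r)}\,u(\mathrm{OPT})$. *)

(* Defs.v *)
From HB Require Import structures.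
From mathcomp Require Export all_boot all_order all_algebra.
From mathcomp Require Export all_classical all_reals all_analysis.
Export Order.TTheory GRing.Theory Num.Theory.
Export numFieldNormedType.Exports.

Set Implicit Arguments.
Unset Strict Implicit.
Unset Printing Implicit Defensive.

Local Open Scope classical_set_scope.
Local Open Scope ring_scope.
Local Open Scope ereal_scope.

Definition independent_RVs (d : measure_display) (T : measurableType d)
    (R : realType) (P : probability T R) (n : nat) (X : 'I_n -> {RV P >-> R}) :
    Prop :=
  forall (J : {set 'I_n}) (B : 'I_n -> set R),
    (forall i, measurable (B i)) ->
    P (\bigcap_(i in [set` J]) (X i @^-1` B i)) =
    \prod_(i in J) P (X i @^-1` B i).

Definition utility (d : measure_display) (T : measurableType d)
    (R : realType) (P : probability T R) (n : nat) (X : 'I_n -> {RV P >-> R})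
    (r : R) (S : {set 'I_n}) : \bar R :=
  'E_P[fun w => ((\sum_(i in S) (X i w) `^ r) `^ r^-1)%R].

(* Ties between means may be broken arbitrarily, so such a set need not be
   unique. *)
Definition highest_mean_set (d : measure_display) (T : measurableType d)
    (R : realType) (P : probability T R) (n : nat) (X : 'I_n -> {RV P >-> R})
    (k : nat) (M : {set 'I_n}) : Prop :=
  #|M| = k /\
  forall i j : 'I_n, i \in M -> j \notin M -> 'E_P[X j] <= 'E_P[X i].

Definition optimal_set (d : measure_display) (T : measurableType d)
    (R : realType) (P : probability T R) (n : nat) (X : 'I_n -> {RV P >-> R})
    (r : R) (k : nat) (OPT : {set 'I_n}) : Prop :=
  #|OPT| = k /\
  forall S : {set 'I_n}, #|S| = k -> utility X r S <= utility X r OPT.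

Definition test_scores (d : measure_display) (T : measurableType d)
    (R : realType) (P : probability T R) (n : nat) (X : 'I_n -> {RV P >-> R}) :
    Prop :=
  [/\ independent_RVs X,
      forall i w, (0 <= X i w)%R
    & forall i, 'E_P[X i] < +oo].

(* Main.v *)
Require Import Defs.
From HB Require Import structures.
From mathcomp Require Import ring lra.
From mathcomp Require Import measurable_realfun.

(** For nonnegative x the l^r norm lies between k^(1/r-1) times the l^1 norm
    (Hoelder) and the l^1 norm, where k is the number of coordinates. Hence
    u(OPT) is at most the sum of the means over OPT, which is at most the sum of
    the means over M, which is at most k^(1-1/r) u(M).

    For tightness, take k scores that are constantly 1 and k independent scores
    that equal 1/p with probability p and 0 otherwise. All means are 1, so the
    constant scores may be selected, with utility k^(1/r). The event that exactly
    one of the risky scores is nonzero shows that their utility is at least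
    k (1-p)^(k-1), which tends to k as p tends to 0. *)

Local Open Scope classical_set_scope.
Local Open Scope ring_scope.

(** * Comparison of the l^r and l^1 norms on finitely many coordinates *)

Section lr_norm.
Variables (R : realType) (I : finType) (x : I -> R) (r : R).
Hypotheses (r1 : 1 <= r) (x0 : forall i, 0 <= x i).

(** With s the l^1 norm, each x_i is at most s, so x_i^r = x_i x_i^(r-1) <= x_i s^(r-1). Summing
    gives s^r, and the r-th root is monotone. *)
Lemma lr_norm_le_sum (A : {set I}) :
  (\sum_(i in A) x i `^ r) `^ r^-1 <= \sum_(i in A) x i.
Proof.
have r0 : 0 < r by exact: lt_le_trans r1.
set s := \sum_(i in A) x i.
have s0 : 0 <= s by apply: sumr_ge0.
have powE (y : R) : 0 <= y -> y `^ r = y * y `^ (r - 1).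
  move=> y0; rewrite -{2}(powRr1 y0) -powRD addrC subrK//.
  by rewrite gt_eqF.
have -> : s = (s `^ r) `^ r^-1 by rewrite -powRrM divff ?gt_eqF// powRr1.
apply: ge0_ler_powR; rewrite ?nnegrE ?invr_ge0 ?powR_ge0 ?(ltW r0)//.
  by apply: sumr_ge0 => i _; exact: powR_ge0.
rewrite (powE s)// mulr_suml; apply: ler_sum => i iA.
rewrite powE// ler_wpM2l//; apply: ge0_ler_powR; rewrite ?nnegrE ?subr_ge0//.
by rewrite /s (bigD1 i)//= lerDl sumr_ge0.
Qed.

(** Induction on the list, with the two-term Hoelder inequality at each step: the vectors are (x_i,
    S^(1/r)) and (1, m^(1-1/r)), where S is the sum of r-th powers over the tail and m its length.
    The case r = 1 is separate because the conjugate exponent is then infinite. *)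
Let sum_le_lr_norm_seq (s : seq I) :
  \sum_(i <- s) x i <=
  (size s)%:R `^ (1 - r^-1) * (\sum_(i <- s) x i `^ r) `^ r^-1.
Proof.
have r0 : 0 < r by exact: lt_le_trans r1.
have [->|rn1] := eqVneq r 1.
  rewrite invr1 subrr powRr0 mul1r powRr1; last first.
    by apply: sumr_ge0 => i _; exact: powR_ge0.
  by apply: ler_sum => i _; rewrite powRr1.
have r1' : 1 < r by rewrite lt_neqAle eq_sym rn1.
have q0 : 0 < 1 - r^-1 by rewrite subr_gt0 invf_lt1.
elim: s => [|i s IH]; first by rewrite !big_nil mulr_ge0 ?powR_ge0.
rewrite !big_cons /=; set S := \sum_(j <- s) x j `^ r in IH *.
have S0 : 0 <= S by apply: sumr_ge0 => j _; exact: powR_ge0.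
have := @hoelder2 R (x i) (S `^ r^-1) 1 ((size s)%:R `^ (1 - r^-1)) r
  (1 - r^-1)^-1 (x0 i) (powR_ge0 _ _) ler01 (powR_ge0 _ _) r0.
rewrite invr_gt0 invrK => /(_ q0).
rewrite addrC subrK => /(_ erefl).
rewrite -!powRrM mulVf ?gt_eqF// divff ?gt_eqF// !powRr1//.
rewrite powR1 mulr1 nat1r => xS; rewrite [leRHS]mulrC.
by apply: le_trans xS; rewrite lerD2l mulrC.
Qed.

Lemma sum_le_lr_norm (A : {set I}) :
  \sum_(i in A) x i <=
  #|A|%:R `^ (1 - r^-1) * (\sum_(i in A) x i `^ r) `^ r^-1.
Proof. by have := sum_le_lr_norm_seq (enum A); rewrite !big_enum -cardE. Qed.

End lr_norm.

(** After the common part of [A] and [B] is cancelled, the two differences have the same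
    cardinality. The least value of [m] on [A :\: B] separates them: it bounds every value on
    [B :\: A] from above. *)
Lemma ler_sum_top (R : realDomainType) (I : finType) (m : I -> R)
    (A B : {set I}) :
  #|A| = #|B| -> (forall i j, i \in A -> j \notin A -> m j <= m i) ->
  \sum_(i in B) m i <= \sum_(i in A) m i.
Proof.
move=> AB top.
rewrite (big_setID A)/= [leRHS](big_setID B)/= finset.setIC lerD2l.
have cAB : #|A :\: B| = #|B :\: A|.
  by apply/eqP; rewrite -(eqn_add2l #|A :&: B|) cardsID finset.setIC cardsID AB.
have [AB0|[i0 i0AB]] := set_0Vmem (A :\: B).
  move: cAB; rewrite AB0 cards0 => /esym/eqP; rewrite cards_eq0 => /eqP ->.
  by rewrite !big_set0.
have [i iAB imin] := @arg_minP _ _ _ i0 (mem (A :\: B)) m i0AB.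
apply: (@le_trans _ _ (m i *+ #|B :\: A|)).
  rewrite -sumr_const; apply: ler_sum => j /setDP[_ jA].
  by apply: top => //; case/setDP: iAB.
by rewrite -cAB -sumr_const; apply: ler_sum => j; exact: imin.
Qed.

(** * The lower bound on u(M) *)

Section bound.
Local Open Scope ereal_scope.
Context {d : measure_display} {T : measurableType d} {R : realType}.
Variable P : probability T R.

Lemma measurable_lr_norm n (X : 'I_n -> {RV P >-> R}) (r : R)
    (S : {set 'I_n}) :
  measurable_fun [set: T]
    (fun w => ((\sum_(i in S) (X i w) `^ r) `^ r^-1)%R).
Proof.
apply: (measurableT_comp (measurable_powR _)).
under eq_fun do rewrite -big_enum; apply: measurable_sum => i.
exact: (measurableT_comp (measurable_powR _)).
Qed.

Lemma ge0_expectation_sum (I : finType) (X : I -> {RV P >-> R}) (A : {set I}) :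
  (forall i w, 0 <= X i w)%R ->
  'E_P[fun w => (\sum_(i in A) X i w)%R] = \sum_(i in A) 'E_P[X i].
Proof.
move=> X0; rewrite unlock.
under eq_integral do rewrite -sumEFin -big_enum.
rewrite ge0_integral_sum ?big_enum//=.
- by move=> i; apply/measurable_EFinP.
- by move=> i w _; rewrite lee_fin.
Qed.

Lemma ge0_expectationZl (X : T -> R) (c : R) :
  measurable_fun [set: T] X -> (forall w, 0 <= X w)%R -> (0 <= c)%R ->
  'E_P[fun w => (c * X w)%R] = c%:E * 'E_P[X].
Proof.
move=> mX X0 c0; rewrite unlock; under eq_integral do rewrite EFinM.
rewrite ge0_integralZl_EFin//; first by move=> w _; rewrite lee_fin.
exact/measurable_EFinP.
Qed.

Lemma utility_top_means (r : R) n k (X : 'I_n -> {RV P >-> R})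
    (M OPT : {set 'I_n}) :
  (1 <= r)%R -> (1 <= k)%N -> test_scores X -> highest_mean_set X k M ->
  #|OPT| = k ->
  (1 / k%:R `^ (1 - 1 / r))%:E * utility X r OPT <= utility X r M.
Proof.
move=> r1 k1 [_ X0 Xoo] [Mk Mtop] OPTk.
have msumX (S : {set 'I_n}) :
    measurable_fun [set: T] (fun w => (\sum_(i in S) X i w)%R).
  by under eq_fun do rewrite -big_enum; exact: measurable_sum.
have sumX0 (S : {set 'I_n}) w : (0 <= \sum_(i in S) X i w)%R.
  exact: sumr_ge0.
have kpos : (0 < k%:R `^ (1 - r^-1) :> R)%R by rewrite powR_gt0// ltr0n.
rewrite !div1r lee_pdivrMl//.
apply: (@le_trans _ _ 'E_P[fun w => (\sum_(i in OPT) X i w)%R]).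
  apply: expectation_le => //; [exact: measurable_lr_norm | |].
    by move=> w; exact: powR_ge0.
  by apply: aeW => w; exact: lr_norm_le_sum.
apply: (@le_trans _ _ 'E_P[fun w => (\sum_(i in M) X i w)%R]).
  (* Finiteness of the means moves the comparison into the reals, where [ler_sum_top] applies. *)
  have EX i : 'E_P[X i] = (fine 'E_P[X i])%:E.
    by rewrite fineK// ge0_fin_numE ?expectation_ge0.
  rewrite !ge0_expectation_sum//.
  under eq_bigr do rewrite EX.
  under [leRHS]eq_bigr do rewrite EX.
  rewrite !sumEFin lee_fin; apply: ler_sum_top => [|i j iM jM].
    by rewrite Mk OPTk.
  by rewrite -lee_fin -!EX; exact: Mtop.
rewrite /utility -ge0_expectationZl//; last 2 first.
- exact: measurable_lr_norm.
- by move=> w; exact: powR_ge0.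
apply: expectation_le => //.
- by apply: measurable_funM => //; exact: measurable_lr_norm.
- by move=> w; rewrite mulr_ge0 ?powR_ge0.
- by apply: aeW => w; rewrite -Mk; exact: sum_le_lr_norm.
Qed.

End bound.

(** * A discrete probability space of n independent biased coins *)

Definition coins (n : nat) := {ffun 'I_n -> bool}.

HB.instance Definition _ n := Finite.on (coins n).
HB.instance Definition _ n := isPointed.Build (coins n) [ffun=> false].
HB.instance Definition _ n := @isMeasurable.Build default_measure_display
  (coins n) discrete_measurable discrete_measurable0
  discrete_measurableC discrete_measurableU.

Section coin_tossing.
Context {R : realType} {n : nat} (p : R) (p01 : 0 <= p <= 1).

Definition coin_weight (f : coins n) : R :=
  \prod_(i < n) (if f i then p else 1 - p).

Lemma coin_weight_ge0 f : 0 <= coin_weight f.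
Proof.
case/andP: p01 => p0 p1; apply: prodr_ge0 => i _.
by case: ifP; rewrite ?subr_ge0.
Qed.

Definition coin_mean (g : coins n -> R) : R := \sum_f coin_weight f * g f.

(** Independence in algebraic form: distributing a product of two-term sums, one per coin, yields a
    sum over all outcomes. A coin outside [J] contributes p + (1 - p) = 1. *)
Lemma coin_mean_prod (F : 'I_n -> bool -> R) (J : {set 'I_n}) :
  coin_mean (fun f => \prod_(i in J) F i (f i)) =
  \prod_(i in J) (p * F i true + (1 - p) * F i false).
Proof.
pose G i b : R := (if b then p else 1 - p) * (if i \in J then F i b else 1).
transitivity (\prod_i \sum_b G i b); last first.
  rewrite [RHS]big_mkcond; apply: eq_bigr => i _.
  rewrite big_bool /G /=; case: ifP => // _.
  by rewrite !mulr1 addrC subrK.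
rewrite bigA_distr_bigA; apply: eq_bigr => f _.
by rewrite big_split /= -big_mkcond.
Qed.

(** [msum] is indexed by natural numbers, so the outcomes are enumerated. The default [point] is
    never reached below [#|coins n|]. *)
Let atom (k : nat) : coins n := nth point (enum (coins n)) k.

Definition coin_prob : set (coins n) -> \bar R :=
  msum (fun k => mscale (NngNum (coin_weight_ge0 (atom k))) \d_(atom k))
       #|coins n|.

HB.instance Definition _ := Measure.on coin_prob.

Let sum_atom (V : nmodType) (F : coins n -> V) :
  \sum_(k < #|coins n|) F (atom k) = \sum_f F f.
Proof.
by rewrite -[RHS]big_enum (big_nth point) -cardE big_mkord.
Qed.

Lemma measurable_coins d (U : sigmaRingType d) (D : set (coins n))
  (g : coins n -> U) : measurable_fun D g.
Proof. by []. Qed.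

Lemma integral_coin_prob (g : coins n -> R) : (forall f, 0 <= g f) ->
  (\int[coin_prob]_f (g f)%:E = (coin_mean g)%:E)%E.
Proof.
move=> g0; rewrite ge0_integral_measure_sum//; last first.
  by move=> f _; rewrite lee_fin.
rewrite /coin_mean -sumEFin -sum_atom; apply: eq_bigr => k _.
rewrite ge0_integral_mscale//; last by move=> f _; rewrite lee_fin.
by rewrite integral_dirac// diracT mul1e.
Qed.

Let coin_prob_setT : coin_prob setT = 1%E.
Proof.
rewrite -[LHS]mul1e -integral_cst// (@integral_coin_prob (cst 1))//.
congr EFin.
(* Writing 1 as an empty product lets [coin_mean_prod] compute the total mass. *)
transitivity (coin_mean (fun f => \prod_(i in finset.set0) (f i)%:R)).
  by apply: eq_bigr => f _; rewrite big_set0.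
by rewrite (coin_mean_prod (fun _ b => b%:R)) big_set0.
Qed.

HB.instance Definition _ :=
  Measure_isProbability.Build _ _ _ coin_prob coin_prob_setT.

Lemma coin_expectation (g : coins n -> R) : (forall f, 0 <= g f) ->
  ('E_coin_prob[g] = (coin_mean g)%:E)%E.
Proof. by move=> g0; rewrite unlock integral_coin_prob. Qed.

Definition coin_rv (v : 'I_n -> bool -> R) (i : 'I_n) (f : coins n) : R :=
  v i (f i).

HB.instance Definition _ v i := isMeasurableFun.Build _ _ _ _ (coin_rv v i)
  (@measurable_coins _ _ setT (coin_rv v i)).

Lemma coin_rv_expectation v i : (forall b, 0 <= v i b) ->
  ('E_coin_prob[coin_rv v i] = (p * v i true + (1 - p) * v i false)%:E)%E.
Proof.
move=> v0; rewrite coin_expectation => [|f]; last exact: v0.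
have := coin_mean_prod v (finset.set1 i); rewrite [RHS]big_set1 => <-.
by congr EFin; apply: eq_bigr => f _; rewrite big_set1.
Qed.

(** The indicator of the intersection is a product of indicators, one per coin, so its mean factors
    by [coin_mean_prod]. The same formula on a singleton identifies each factor as a marginal
    probability. *)
Lemma coin_rv_independent (v : 'I_n -> bool -> R) :
  @independent_RVs _ _ _ coin_prob n
    (fun i => coin_rv v i : {RV coin_prob >-> R}).
Proof.
move=> J B mB.
have probE (K : {set 'I_n}) :
    coin_prob (\bigcap_(i in [set` K]) (coin_rv v i @^-1` B i)) =
    (\prod_(i in K)
        (p * \1_(B i) (v i true) + (1 - p) * \1_(B i) (v i false)))%:E.
  rewrite -expectation_indic// coin_expectation => [|f]; last first.
    by rewrite indicE.
  rewrite -(coin_mean_prod (fun i b => \1_(B i) (v i b))).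
  congr EFin; apply: eq_bigr => f _; congr (_ * _).
  rewrite indicE; case: (boolP (f \in _)) => [/set_mem fB|/negP fB].
    by rewrite big1// => i iK; rewrite indicE mem_set//; exact: fB.
  apply/esym/eqP; apply: contrapT => /negP/prodf_neq0 nz; apply: fB.
  apply/mem_set => i /= /nz; rewrite indicE pnatr_eq0 eqb0 negbK.
  exact: set_mem.
apply: etrans (probE J) _; rewrite -prodEFin; apply: eq_bigr => i _.
have /= := probE (finset.set1 i); rewrite (big_set1 _ i) => <-.
congr (coin_prob _); apply/seteqP; split => f /= fB.
  by apply: (fB i); rewrite /= finset.set11.
by move=> j /= /finset.set1P ->.
Qed.

End coin_tossing.

(** The left side is [c] if exactly one [b i] with i in [A] is true, and 0 otherwise; a single true
    coordinate already makes the norm at least [c]. Being a sum of products over coordinates, this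
    minorant has a mean computable by [coin_mean_prod]. *)
Lemma exactly_one_le_lr_norm {R : realType} {I : finType} (A : {set I})
    (b : I -> bool) {c r : R} :
  0 <= c -> 1 <= r ->
  \sum_(j in A) \prod_(i in A)
      (if i == j then (if b i then c else 0) else (~~ b i)%:R) <=
  (\sum_(i in A) (if b i then c else 0) `^ r) `^ r^-1.
Proof.
move=> c0 r1; have r0 : 0 < r by exact: lt_le_trans r1.
have [/exists_inP[j jA bj]|/exists_inPn nb] := boolP [exists j in A, b j].
  rewrite (bigD1 j)//= [X in _ + X]big1 ?addr0; last first.
    move=> j' /andP[j'A jj']; rewrite (bigD1 j)//= eq_sym (negbTE jj') bj.
    by rewrite mul0r.
  apply: (@le_trans _ _ c).
    rewrite (bigD1 j)//= eqxx bj ler_piMr// prodr_ile1// => i /andP[iA ij].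
    by rewrite (negbTE ij); case: (b i); rewrite /= ?lexx ler01.
  rewrite -{1}(powRr1 c0) -(mulfV (lt0r_neq0 r0)) powRrM.
  apply: ge0_ler_powR; rewrite ?nnegrE ?invr_ge0 ?powR_ge0 ?(ltW r0)//.
    by apply: sumr_ge0 => i _; exact: powR_ge0.
  rewrite (bigD1 j)//= bj lerDl.
  by apply: sumr_ge0 => i _; exact: powR_ge0.
rewrite big1 ?powR_ge0// => j jA; rewrite (bigD1 j)//= eqxx.
by rewrite (negbTE (nb _ jA)) mul0r.
Qed.

Lemma exprn_Bernoulli (R : realDomainType) (p : R) (n : nat) :
  0 <= p <= 1 -> 1 - p *+ n <= (1 - p) ^+ n.
Proof.
move=> /andP[p0 p1]; elim: n => [|n IH]; first by rewrite mulr0n subr0.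
rewrite exprS; apply: (@le_trans _ _ ((1 - p) * (1 - p *+ n))); last first.
  by rewrite ler_wpM2l ?subr_ge0.
rewrite mulrBl mul1r mulrBr mulr1 opprB mulrS.
have : 0 <= p * (p *+ n) by rewrite mulr_ge0 ?mulrn_wge0.
by lra.
Qed.

(** * The example with safe and risky scores *)

Section tightness.
Context {R : realType} (k : nat) (r p : R).
Hypotheses (r1 : 1 <= r) (p0 : 0 < p) (p1 : p <= 1).

Let p01 : 0 <= p <= 1. Proof. by rewrite ltW. Qed.

Let P : probability (coins (k + k)) R := coin_prob p p01.

Definition safe_or_risky (i : 'I_(k + k)) (b : bool) : R :=
  if (i < k)%N then 1 else if b then p^-1 else 0.

Lemma safe_or_risky_ge0 i b : 0 <= safe_or_risky i b.
Proof.
rewrite /safe_or_risky; case: ifP => // _.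
by case: b => //; rewrite invr_ge0 ltW.
Qed.

Definition tight_scores (i : 'I_(k + k)) : {RV P >-> R} :=
  coin_rv safe_or_risky i.

Definition safe_set : {set 'I_(k + k)} := [set lshift k j | j in 'I_k]%SET.
Definition risky_set : {set 'I_(k + k)} := [set rshift k j | j in 'I_k]%SET.

Lemma tight_scores_mean i : ('E_P[tight_scores i] = 1)%E.
Proof.
rewrite coin_rv_expectation => [|b]; last exact: safe_or_risky_ge0.
congr EFin; rewrite /safe_or_risky; case: ifP => _; first by lra.
by rewrite mulr0 addr0 mulfV// gt_eqF.
Qed.

Lemma tight_scores_valid : test_scores tight_scores.
Proof.
split; first exact: coin_rv_independent.
- by move=> i w; exact: safe_or_risky_ge0.
- by move=> i; rewrite tight_scores_mean ltry.
Qed.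

Lemma card_safe_set : #|safe_set| = k.
Proof. by rewrite card_imset ?card_ord//; exact: lshift_inj. Qed.

Lemma card_risky_set : #|risky_set| = k.
Proof. by rewrite card_imset ?card_ord//; exact: rshift_inj. Qed.

Lemma utility_safe_set : utility tight_scores r safe_set = (k%:R `^ r^-1)%:E.
Proof.
rewrite -(expectation_cst P) /utility; congr ('E_P[_])%E.
apply/funext => w /=; congr (_ `^ _).
rewrite (eq_bigr (fun=> 1)) => [|_ /imsetP[j _ ->]]; last first.
  by rewrite /tight_scores /coin_rv /safe_or_risky /= ltn_ord powR1.
by rewrite sumr_const card_safe_set.
Qed.

Lemma utility_risky_set :
  ((k%:R * (1 - p) ^+ k.-1)%:E <= utility tight_scores r risky_set)%E.
Proof.
rewrite /utility coin_expectation; last by move=> f; exact: powR_ge0.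
rewrite lee_fin.
pose F (j i : 'I_(k + k)) b : R :=
  if i == j then (if b then p^-1 else 0) else (~~ b)%:R.
apply: (@le_trans _ _ (coin_mean p (fun f : coins (k + k) =>
    \sum_(j in risky_set) \prod_(i in risky_set) F j i (f i)))); last first.
  apply: ler_sum => f _; rewrite ler_wpM2l ?coin_weight_ge0//.
  have pV0 : 0 <= p^-1 by rewrite invr_ge0 ltW.
  apply: le_trans (exactly_one_le_lr_norm risky_set f pV0 r1) _.
  rewrite le_eqVlt; apply/orP; left; apply/eqP.
  congr (_ `^ _); apply: eq_bigr => i /imsetP[j _ ->].
  rewrite [tight_scores _ _]/(safe_or_risky _ _) /safe_or_risky.
  by rewrite ltnNge leq_addr.
rewrite /coin_mean; under eq_bigr do rewrite mulr_sumr.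
rewrite exchange_big /=; under eq_bigr do rewrite -/(coin_mean _ _).
(* In the mean of the j-th product, coin j gives p p^(-1) = 1 and each of the other k - 1 risky
   coins gives the probability 1 - p of a zero score. *)
rewrite (eq_bigr (fun=> (1 - p) ^+ k.-1)); last first.
  move=> j jA; rewrite [LHS](coin_mean_prod _ (F j)) (bigD1 j)//= /F eqxx.
  rewrite mulr0 addr0 mulfV ?gt_eqF// mul1r.
  rewrite (eq_bigr (fun=> 1 - p)) => [|i /andP[_ /negbTE ->]]; last first.
    by rewrite mulr0 add0r mulr1.
  rewrite prodr_const; congr (_ ^+ _).
  rewrite -[in RHS]card_risky_set (cardsD1 j) jA /=.
  by apply: eq_card => i; rewrite !inE andbC.
by rewrite sumr_const card_risky_set mulr_natl.
Qed.

End tightness.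

(** * The bound and its tightness combined *)

Local Open Scope ereal_scope.

Theorem theorem5 (R : realType) :
  (forall (d : measure_display) (T : measurableType d) (P : probability T R)
      (r : R) (n k : nat) (X : 'I_n -> {RV P >-> R}) (M OPT : {set 'I_n}),
    (1 <= r)%R -> (1 <= k)%N -> (k <= n)%N ->
    test_scores X ->
    highest_mean_set X k M ->
    optimal_set X r k OPT ->
    utility X r M >= (1 / k%:R `^ (1 - 1 / r))%:E * utility X r OPT)
  /\
  (forall (k : nat) (r delta : R),
    (1 <= k)%N -> (1 <= r)%R -> (0 < delta)%R ->
    exists (d : measure_display) (T : measurableType d) (P : probability T R)
      (n : nat) (X : 'I_n -> {RV P >-> R}) (M OPT : {set 'I_n}),
      [/\ (k <= n)%N /\ test_scores X,
          highest_mean_set X k M,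
          optimal_set X r k OPT,
          0 < utility X r OPT
        & utility X r M <=
          ((1 + delta) * k%:R `^ (- (1 - 1 / r)))%:E * utility X r OPT]).
Proof.
split=> [d T P r n k X M OPT r1 k1 _ testX topM [OPTk _]|
         k r delta k1 r1 delta0].
  exact: utility_top_means.
have k0 : (0 < k%:R :> R)%R by rewrite ltr0n.
have d1 : (0 < 1 + delta)%R by rewrite addr_gt0.
(* This p solves 1 - k p = 1 / (1 + delta). *)
pose p : R := (delta / (1 + delta) / k%:R)%R.
have pk : (p *+ k = 1 - (1 + delta)^-1)%R.
  by rewrite -mulr_natr divfK ?gt_eqF//; field; rewrite gt_eqF.
have p0 : (0 < p)%R by rewrite !divr_gt0.
have p1 : (p <= 1)%R.
  apply: (@le_trans _ _ (p *+ k)%R).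
    by rewrite -{1}(mulr1n p) ler_pMn2l.
  by rewrite pk lerBlDr lerDl invr_ge0 ltW.
pose X := tight_scores k p p0 p1.
have [OPT /eqP OPTk OPTmax] := @arg_maxP _ _ _ (risky_set k)
  (fun S : {set 'I_(k + k)} => #|S| == k) (utility X r)
  (introT eqP (card_risky_set k)).
(* The risky set competes with [OPT], and Bernoulli's inequality gives (1-p)^(k-1) >= 1 - (k-1)p >=
   1 - kp = 1/(1+delta). *)
have OPTge : (k%:R / (1 + delta))%:E <= utility X r OPT.
  apply: le_trans (OPTmax _ (introT eqP (card_risky_set k))).
  apply: le_trans (utility_risky_set k r p r1 p0 p1).
  rewrite lee_fin ler_wpM2l//.
  have p01 : (0 <= p <= 1)%R by rewrite ltW.
  apply: le_trans (exprn_Bernoulli _ _ _ p01).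
  apply: (@le_trans _ _ (1 - p *+ k)%R); first by rewrite pk subKr.
  by rewrite lerB// ler_pMn2l// leq_pred.
exists default_measure_display, (coins (k + k)), _, (k + k)%N, X.
exists (safe_set k), OPT; split.
- split; first exact: leq_addr.
  exact: tight_scores_valid.
- split; first exact: card_safe_set.
  by move=> i j _ _; rewrite !tight_scores_mean.
- by split=> // S Sk; apply: OPTmax; apply/eqP.
- by apply: lt_le_trans OPTge; rewrite lte_fin divr_gt0.
- rewrite utility_safe_set div1r.
  have c0 : (0 <= (1 + delta) * k%:R `^ (- (1 - r^-1)) :> R)%R.
    by rewrite mulr_ge0 ?powR_ge0// ltW.
  apply: le_trans (lee_wpmul2l _ OPTge); last by rewrite lee_fin.
  (* Splitting off a factor k from the safe utility matches it with k/(1+delta) from [OPTge]; the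
     factors 1+delta then cancel. *)
  have -> : (k%:R `^ r^-1 = k%:R `^ (- (1 - r^-1)) * k%:R :> R)%R.
    rewrite -[X in (_ * X)%R](powRr1 (ltW k0)) -powRD opprB ?subrK//.
    by rewrite (gt_eqF k0) implybT.
  by rewrite -EFinM lee_fin -mulrA [leRHS]mulrC mulrA divfK ?gt_eqF.
Qed.
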